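(* Let $((A,\phi_0),(A^*,X_0))$ be a generalized Lie bialgebroid over a manifold $M$. Then the bracket of functions $\{\,,\,\}:C^\infty(M,\mathbb R)\times C^\infty(M,\mathbb R)\to C^\infty(M,\mathbb R)$ given by $$\{f,g\}:=-\,d_{\phi_0}f\cdot d_{*X_0}g,\qquad f,g\in C^\infty(M,\mathbb R),$$ where $\cdot$ is the pairing between $\Gamma(A^* )$ and $\Gamma(A)$, defines a Jacobi structure on $M$.
   Context: Lie algebroid $(A,[\,,\,],\rho)$ over $M$: real vector bundle $A\to M$, Lie bracket on $\Gamma(A)$, anchor $\rho:A\to TM$ inducing a Lie algebra homomorphism $\Gamma(A)\to\mathfrak X(M)$, with $[X,fY]=f[X,Y]+\rho(X)(f)Y$. Its differential $d:\Gamma(\wedge^kA^* )\to\Gamma(\wedge^{k+1}A^* )$ is $(d\omega)(X_0,\dots,X_k)=\sum_i(-1)^i\rho(X_i)(\omega(\dots,\hat X_i,\dots))+\sum_{i<j}(-1)^{i+j}\omega([X_i,X_j],\dots,\hat X_i,\dots,\hat X_j,\dots)$. $\phi_0\in\Gamma(A^* )$ is a 1-cocycle if $d\phi_0=0$. Schouten bracket on $\Gamma(\wedge^*A)$: the $\mathbb R$-bilinear extension of the bracket with $[X,f]=\rho(X)(f)$, $[P,P']=(-1)^{kk'}[P',P]$, $[P,P'\wedge P'']=[P,P']\wedge P''+(-1)^{k'(k+1)}P'\wedge[P,P'']$ ($k,k'$ the degrees of $P,P'$); same convention for multivector fields. For a 1-cocycle $\phi_0$ of $A$: the $\phi_0$-differential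 is $d_{\phi_0}\omega=d\omega+\phi_0\wedge\omega$; the $\phi_0$-Lie derivative on $\Gamma(\wedge^kA^* )$ is $(\mathcal L_{\phi_0})_X=d_{\phi_0}\circ i_X+i_X\circ d_{\phi_0}$; the $\phi_0$-Schouten bracket is $[P,P']_{\phi_0}=[P,P']+(-1)^{k+1}(k-1)P\wedge i_{\phi_0}P'-(k'-1)(i_{\phi_0}P)\wedge P'$ (contraction in the first slot); and for $P\in\Gamma(\wedge^kA)$, $(\mathcal L_{\phi_0})_XP=[X,P]_{\phi_0}$. Generalized Lie bialgebroid: let $A\to M$ be a vector bundle with Lie algebroid structures $([\,,\,],\rho)$ on $A$ and $([\,,\,]_*,\rho_* )$ on the dual bundle $A^*$, $\phi_0\in\Gamma(A^* )$ a 1-cocycle of $A$ and $X_0\in\Gamma(A)$ a 1-cocycle of $A^*$. Let $d_*$, $d_{*X_0}$, $\mathcal L_{*X_0}$ be the differential, $X_0$-differential and $X_0$-Lie derivative of $A^*$ (acting on $\Gamma(\wedge^kA)$). The pair $((A,\phi_0),(A^*,X_0))$ is a generalized Lie bialgebroid over $M$ if for all $X,Y\in\Gamma(A)$ and $P\in\Gamma(\wedge^kA)$ (all $k$): $$d_{*X_0}[X,Y]=[X,d_{*X_0}Y]_{\phi_0}-[Y,d_{*X_0}X]_{\phi_0},\qquad(\mathcal L_{*X_0})_{\phi_0}P+(\mathcal L_{\phi_0})_{X_0}P=0.$$ Jacobi structure on $M$: a pair $(\Lambda,E)$, $\Lambda$ a 2-vector and $E$ a vector field, with $[\Lambda,\Lambda]=2E\wedge\Lambda$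 and $[E,\Lambda]=0$. Its Jacobi bracket is $\{f,g\}=\Lambda(\delta f,\delta g)+fE(g)-gE(f)$ ($\delta$ the de Rham differential). A bracket on $C^\infty(M,\mathbb R)$ defines a Jacobi structure if it is the Jacobi bracket of some Jacobi structure; equivalently, if it is $\mathbb R$-bilinear, skew-symmetric, satisfies the Jacobi identity and is a first-order differential operator in each argument.
   Formalization: The formal theorem assumes that the rank of A is not 1; for line bundles the claim fails, e.g. A = Tℝ, ρ_*(dx) = d/dx, [a dx, b dx]_* = (ab' − ba')dx, φ_0 = 0, X_0 = 0, where {f,g} = −f'g' is not skew-symmetric. *)

(* Defs.v *)
From HB Require Import structures.
From mathcomp Require Import all_boot all_order all_algebra.
From mathcomp Require Import all_classical all_reals all_analysis.
Set Implicit Arguments.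
Unset Strict Implicit.
Unset Printing Implicit Defensive.
From mathcomp Require Import ring.
Import Order.TTheory GRing.Theory Num.Theory.
Import numFieldNormedType.Exports.
Local Open Scope classical_set_scope.
Local Open Scope ring_scope.

Section SmoothEuclidean.
Variables (R : realType) (n : nat).
Implicit Types (U : set 'rV[R]_n) (f g : 'rV[R]_n -> R).

Fixpoint Ck (k : nat) U f : Prop :=
  (forall x, U x -> {for x, continuous f}) /\
  (if k is k'.+1 then
     forall v, (forall x, U x -> derivable f x v) /\ Ck k' U ('D_v f)
   else True).

Definition smooth_on U f := forall k, Ck k U f.

(* f is, near x, a smooth function of phi *)
Definition smooth_via (T : topologicalType) (phi : T -> 'rV[R]_n) (x : T)
    (f : T -> R) :=
  exists U g, [/\ open U, U (phi x), smooth_on U g &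
    \forall y \near x, f y = g (phi y)].

Lemma Ck_sub k U V f : U `<=` V -> Ck k V f -> Ck k U f.
Proof.
elim: k U V f => [|k IH] U V f UV /= [cf df]; split => //.
- by move=> x /UV /cf.
- by move=> x /UV /cf.
- by move=> v; have [d1 d2] := df v; split=> [x /UV /d1//|]; exact: (IH _ V).
Qed.

Lemma Ck_W k U f : Ck k.+1 U f -> Ck k U f.
Proof.
elim: k U f => [|k IH] U f; first by case.
by case=> cf df; split => // v; have [d1 d2] := df v; split => //; exact: IH.
Qed.

Lemma near_continuous_for (f g : 'rV[R]_n -> R) (x : 'rV[R]_n) :
  (\near x, f x = g x) -> {for x, continuous f} -> {for x, continuous g}.
Proof.
move=> fg cf; have e : f x = g x := nbhs_singleton fg.
suff : g @ x --> f x by rewrite e.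
exact: cvg_trans (near_eq_cvg fg) cf.
Qed.

Lemma Ck_eq k U f g : open U -> {in U, f =1 g} -> Ck k U f -> Ck k U g.
Proof.
move=> oU; elim: k f g => [|k IH] f g fg /= [cf df].
  split => // x Ux; apply: near_continuous_for (cf _ Ux).
  by near=> y; apply: fg; rewrite inE; near: y; exact: open_nbhs_nbhs.
have nfg x : U x -> \forall y \near x, f y = g y.
  move=> Ux; near=> y; apply: fg; rewrite inE.
  by near: y; exact: open_nbhs_nbhs.
split=> [x Ux|v]; first by apply: near_continuous_for (cf _ Ux); exact: nfg.
have [d1 d2] := df v; split=> [x Ux|].
  by apply: near_eq_derivable (d1 _ Ux) => //; exact: nfg.
apply: IH d2 => x /set_mem Ux.
by apply: near_eq_derive => //; exact: nfg.
Unshelve. all: by end_near. Qed.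

Lemma Ck_cst k U c : Ck k U (cst c).
Proof.
elim: k c => [|k IH] c /=; split => //; try by move=> x _; exact: cst_continuous.
move=> v; split => [x _|]; first exact: derivable_cst.
suff -> : 'D_v (cst c : 'rV[R]_n -> R) = cst 0 by exact: IH.
by apply/funext => x; rewrite derive_cst.
Qed.

Lemma Ck_D k U f g : open U -> Ck k U f -> Ck k U g -> Ck k U (f + g).
Proof.
move=> oU; elim: k f g => [|k IH] f g /= [cf df] [cg dg]; split => //.
- by move=> x Ux; exact: continuousD (cf x Ux) (cg x Ux).
- by move=> x Ux; exact: continuousD (cf x Ux) (cg x Ux).
- move=> v; have [df1 df2] := df v; have [dg1 dg2] := dg v; split.
    by move=> x Ux; apply: derivableD; [exact: df1 | exact: dg1].
  apply: (@Ck_eq _ _ ('D_v f + 'D_v g)) => //; last exact: IH.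
  by move=> x /set_mem Ux; rewrite deriveD //; [exact: df1 | exact: dg1].
Qed.

Lemma Ck_M k U f g : open U -> Ck k U f -> Ck k U g -> Ck k U (f * g).
Proof.
move=> oU; elim: k f g => [|k IH] f g /= [cf df] [cg dg]; split => //.
- by move=> x Ux; exact: continuousM (cf x Ux) (cg x Ux).
- by move=> x Ux; exact: continuousM (cf x Ux) (cg x Ux).
- move=> v; have [df1 df2] := df v; have [dg1 dg2] := dg v; split.
    by move=> x Ux; apply: derivableM; [exact: df1 | exact: dg1].
  apply: (@Ck_eq _ _ (f * 'D_v g + g * 'D_v f)) => //.
    by move=> x /set_mem Ux; rewrite deriveM //; [exact: df1 | exact: dg1].
  by apply: Ck_D => //; apply: IH => //; apply: Ck_W; split.
Qed.

Variable (T : topologicalType).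
Implicit Types (phi : T -> 'rV[R]_n) (a b : T -> R).

Lemma smooth_via_eq phi x a b : (\forall y \near x, a y = b y) ->
  smooth_via phi x a -> smooth_via phi x b.
Proof.
move=> ab [U [g [oU Ux sg ag]]]; exists U, g; split => //.
by near=> y; rewrite -(near ab y) //; near: y.
Unshelve. all: by end_near. Qed.

Lemma smooth_via_cst phi x c : smooth_via phi x (cst c).
Proof.
exists setT, (cst c); split => //; first exact: openT.
  by move=> k; exact: Ck_cst.
by near=> y.
Unshelve. all: by end_near. Qed.

Lemma smooth_via_D phi x a b :
  smooth_via phi x a -> smooth_via phi x b -> smooth_via phi x (a + b).
Proof.
move=> [U [g [oU Ux sg ag]]] [V [h [oV Vx sh bh]]].
exists (U `&` V), (g + h); split => //; first exact: openI.
  move=> k; apply: Ck_D; first exact: openI.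
    by apply: (@Ck_sub _ _ U) (sg k) => y [].
  by apply: (@Ck_sub _ _ V) (sh k) => y [].
near=> y; rewrite -[LHS]/(a y + b y) -[RHS]/(g (phi y) + h (phi y)).
by congr (_ + _); near: y.
Unshelve. all: by end_near. Qed.

Lemma smooth_via_M phi x a b :
  smooth_via phi x a -> smooth_via phi x b -> smooth_via phi x (a * b).
Proof.
move=> [U [g [oU Ux sg ag]]] [V [h [oV Vx sh bh]]].
exists (U `&` V), (g * h); split => //; first exact: openI.
  move=> k; apply: Ck_M; first exact: openI.
    by apply: (@Ck_sub _ _ U) (sg k) => y [].
  by apply: (@Ck_sub _ _ V) (sh k) => y [].
near=> y; rewrite -[LHS]/(a y * b y) -[RHS]/(g (phi y) * h (phi y)).
by congr (_ * _); near: y.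
Unshelve. all: by end_near. Qed.

End SmoothEuclidean.

(* A smooth manifold of dimension n; the chart [chart i] is meaningful on
   [cdom i] only, where it is a homeomorphism onto an open set. *)
Record manifold (R : realType) (n : nat) := Manifold {
  mpoint :> topologicalType;
  mhausdorff : hausdorff_space mpoint;
  msecond_countable : @second_countable mpoint;
  chart_index : Type;
  cdom : chart_index -> set mpoint;
  chart : chart_index -> mpoint -> 'rV[R]_n;
  cdom_open : forall i, open (cdom i);
  cdom_cover : forall x, exists i, cdom i x;
  chart_inj : forall i, {in cdom i &, injective (chart i)};
  chart_continuous : forall i x, cdom i x -> {for x, continuous (chart i)};
  chart_open : forall i (V : set mpoint),
    open V -> V `<=` cdom i -> open (chart i @` V);
  chart_smooth : forall i j x, cdom i x -> cdom j x ->
    forall k, smooth_via (chart i) x (fun y => chart j y ord0 k)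
}.

Section SmoothFunctions.
Variables (R : realType) (n : nat) (M : manifold R n).

Definition smooth_at (f : M -> R) (x : M) :=
  forall i, cdom i x -> smooth_via (chart i) x f.

Lemma smooth_at_eq f g x : (\forall y \near x, f y = g y) ->
  smooth_at f x -> smooth_at g x.
Proof. by move=> fg sf i ix; exact: smooth_via_eq fg (sf i ix). Qed.

Lemma smooth_at_cst c x : smooth_at (cst c) x.
Proof. by move=> i _; exact: smooth_via_cst. Qed.

Lemma smooth_atD f g x : smooth_at f x -> smooth_at g x -> smooth_at (f + g) x.
Proof. by move=> sf sg i ix; apply: smooth_via_D; [exact: sf|exact: sg]. Qed.

Lemma smooth_atM f g x : smooth_at f x -> smooth_at g x -> smooth_at (f * g) x.
Proof. by move=> sf sg i ix; apply: smooth_via_M; [exact: sf|exact: sg]. Qed.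

Definition smooth_fun : {pred M -> R} := fun f => `[< forall x, smooth_at f x >].

Lemma smooth_fun_subring : subring_closed smooth_fun.
Proof.
have sM f g : f \in smooth_fun -> g \in smooth_fun -> f * g \in smooth_fun.
  move=> /asboolP sf /asboolP sg; apply/asboolP => x.
  exact: smooth_atM.
split => //.
- by apply/asboolP => x; exact: smooth_at_cst.
- move=> f g /asboolP sf /asboolP sg; apply/asboolP => x.
  have -> : f - g = f + cst (-1) * g.
    by apply/funext => y; rewrite -[RHS]/(f y + -1 * g y) mulN1r.
  by apply: smooth_atD => //; apply: smooth_atM => //; exact: smooth_at_cst.
Qed.

Record Cinf := MkCinf { cinf_val :> M -> R; _ : cinf_val \in smooth_fun }.
HB.instance Definition _ := [isSub for cinf_val].
HB.instance Definition _ := [Choice of Cinf by <:].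
HB.instance Definition _ :=
  GRing.SubChoice_isSubComPzRing.Build _ _ Cinf smooth_fun_subring.

Lemma cst_smooth (c : R) : (cst c : M -> R) \in smooth_fun.
Proof. by apply/asboolP => x; exact: smooth_at_cst. Qed.

Definition cinf_cst (c : R) : Cinf := MkCinf (cst_smooth c).

End SmoothFunctions.

Arguments cinf_cst {R n} M c.

(* A smooth vector bundle of rank r, given by local frames; [coord t i x] is
   meaningful for x in [tdom t] only, where it is the i-th coordinate in the
   frame [frame t]. *)
Record vbundle (R : realType) (n : nat) (M : manifold R n) (r : nat) :=
Vbundle {
  fib : M -> lmodType R;
  triv : Type;
  tdom : triv -> set M;
  tdom_open : forall t, open (tdom t);
  tdom_cover : forall x, exists t, tdom t x;
  frame : triv -> 'I_r -> forall x, fib x;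
  coord : triv -> 'I_r -> forall x, fib x -> R;
  frame_span : forall t x, tdom t x -> forall v : fib x,
    \sum_i coord t i v *: frame t i x = v;
  frame_free : forall t x, tdom t x -> forall (c : 'I_r -> R) i,
    coord t i (\sum_j c j *: frame t j x) = c i;
  transition_smooth : forall s t x, tdom s x -> tdom t x -> forall i j,
    smooth_at (fun y => coord t i (frame s j y)) x
}.

Section Sections.
Variables (R : realType) (n r : nat) (M : manifold R n) (A : vbundle M r).

Definition rough_section := forall x : M, fib A x.
HB.instance Definition _ := gen_eqMixin rough_section.
HB.instance Definition _ := gen_choiceMixin rough_section.

Implicit Types X Y Z : rough_section.

Definition rs_zero : rough_section := fun x => 0.
Definition rs_add X Y : rough_section := fun x => X x + Y x.
Definition rs_opp X : rough_section := fun x => - X x.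
Definition rs_scale (f : Cinf M) X : rough_section := fun x => f x *: X x.

Let rs_ext X Y : (forall x, X x = Y x) -> X = Y.
Proof. exact: functional_extensionality_dep. Qed.

Fact rs_addA : associative rs_add.
Proof. by move=> X Y Z; apply: rs_ext => x; exact: addrA. Qed.
Fact rs_addC : commutative rs_add.
Proof. by move=> X Y; apply: rs_ext => x; exact: addrC. Qed.
Fact rs_add0 : left_id rs_zero rs_add.
Proof. by move=> X; apply: rs_ext => x; exact: add0r. Qed.
Fact rs_addN : left_inverse rs_zero rs_opp rs_add.
Proof. by move=> X; apply: rs_ext => x; exact: addNr. Qed.

HB.instance Definition _ :=
  GRing.isZmodule.Build rough_section rs_addA rs_addC rs_add0 rs_addN.

Fact rs_scaleA f g X : rs_scale f (rs_scale g X) = rs_scale (f * g) X.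
Proof. by apply: rs_ext => x; exact: scalerA. Qed.
Fact rs_scale1 : left_id 1 rs_scale.
Proof. by move=> X; apply: rs_ext => x; exact: scale1r. Qed.
Fact rs_scaleDr : right_distributive rs_scale +%R.
Proof. by move=> f X Y; apply: rs_ext => x; exact: scalerDr. Qed.
Fact rs_scaleDl X : {morph rs_scale^~ X : f g / f + g}.
Proof. by move=> f g; apply: rs_ext => x; exact: scalerDl. Qed.

HB.instance Definition _ := GRing.Zmodule_isLmodule.Build (Cinf M) rough_section
  rs_scaleA rs_scale1 rs_scaleDr rs_scaleDl.

Definition smooth_section : {pred rough_section} := fun X =>
  `[< forall t x, tdom t x -> forall i : 'I_r,
        smooth_at (fun y => coord t i (X y)) x >].

Lemma coordZD t x (a : R) (u v : fib A x) i : tdom t x ->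
  coord t i (a *: u + v) = a * coord t i u + coord t i v.
Proof.
move=> tx; pose c j := a * coord t j u + coord t j v.
rewrite -[RHS](frame_free tx c i); congr coord.
rewrite -[in LHS](frame_span tx u) -[in LHS](frame_span tx v).
rewrite scaler_sumr -big_split /=; apply: eq_bigr => j _.
by rewrite scalerA -scalerDl.
Qed.

Lemma smooth_section_submod : submod_closed smooth_section.
Proof.
split=> [|f X Y /asboolP sX /asboolP sY]; apply/asboolP => t x tx i;
    have ntx : \forall y \near x, tdom t y :=
      open_nbhs_nbhs (conj (tdom_open t) tx).
  apply: (@smooth_at_eq _ _ _ (cst 0)); last exact: smooth_at_cst.
  near=> y.
  have ty : tdom t y by near: y; exact: ntx.
  have e : (0 : rough_section) y = -1 *: (0 : fib A y) + 0.
    by rewrite scaler0 addr0.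
  by rewrite e coordZD // mulN1r addNr.
apply: (@smooth_at_eq _ _ _
  (cinf_val f * (fun y => coord t i (X y)) + (fun y => coord t i (Y y)))).
  near=> y; have ty : tdom t y by near: y; exact: ntx.
  by rewrite [RHS](coordZD (f y) (X y) (Y y) i ty).
apply: smooth_atD; last exact: sY.
apply: smooth_atM; last exact: sX.
by case: f => f /= /asboolP.
Unshelve. all: by end_near. Qed.

Record Gamma := MkGamma { gamma_val :> rough_section;
  _ : gamma_val \in smooth_section }.
HB.instance Definition _ := [isSub for gamma_val].
HB.instance Definition _ := [Choice of Gamma by <:].
HB.instance Definition _ :=
  GRing.SubChoice_isSubLmodule.Build _ _ _ Gamma smooth_section_submod.

End Sections.

Section Dual.
Variables (R : realType) (n : nat) (M : manifold R n) (L : lmodType (Cinf M)).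
Local Notation K := (Cinf M).

Definition lin_form : {pred L -> K^o} := fun a =>
  `[< forall (f : K) X Y, a (f *: X + Y) = f * a X + a Y >].

Lemma lin_form_submod : submod_closed lin_form.
Proof.
split=> [|f a b /asboolP la /asboolP lb]; apply/asboolP => g X Y.
  by rewrite -[LHS]/(0 : K) -[RHS]/(g * 0 + 0 : K) mulr0 addr0.
rewrite -[LHS]/(f * a (g *: X + Y) + b (g *: X + Y) : K).
rewrite -[RHS]/(g * (f * a X + b X) + (f * a Y + b Y) : K).
by rewrite la lb !mulrDr addrACA mulrCA.
Qed.

(* For L the module of sections of a vector bundle A, this is the module of
   sections of the dual bundle, a section alpha being identified with the
   C^oo(M)-linear map X |-> <alpha, X>. *)
Record dual_mod := MkDual { dual_val :> L -> K^o; _ : dual_val \in lin_form }.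
HB.instance Definition _ := [isSub for dual_val].
HB.instance Definition _ := [Choice of dual_mod by <:].
HB.instance Definition _ :=
  GRing.SubChoice_isSubLmodule.Build _ _ _ dual_mod lin_form_submod.

Lemma dual_linear (a : dual_mod) (f : K) X Y : a (f *: X + Y) = f * a X + a Y.
Proof. by case: a => a /= /asboolP. Qed.

Lemma dualD (a : dual_mod) X Y : a (X + Y) = a X + a Y :> K.
Proof. by rewrite -[X in LHS]scale1r dual_linear mul1r. Qed.

Lemma dualZ (a : dual_mod) f X : a (f *: X) = f * a X :> K.
Proof.
have a0 : a 0 = 0 :> K by apply: (addIr (a 0 : K)); rewrite -dualD !add0r.
by rewrite -[f *: X]addr0 dual_linear a0 addr0.
Qed.

End Dual.

Section BiDual.
Variables (R : realType) (n : nat) (M : manifold R n) (L : lmodType (Cinf M)).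

Lemma eval_dual_lin (X : L) :
  (fun a : dual_mod L => a X) \in @lin_form R n M (dual_mod L).
Proof. by apply/asboolP => f a b. Qed.

(* A section of A seen as a section of the dual of the dual bundle. *)
Definition eval_dual (X : L) : dual_mod (dual_mod L) := MkDual (eval_dual_lin X).

End BiDual.

Section Derivations.
Variables (R : realType) (n : nat) (M : manifold R n).
Local Notation K := (Cinf M).

(* Vector fields on M are identified with derivations of C^oo(M). *)
Definition derivation (D : K -> K) :=
  (forall (c : R) f g, D (cinf_cst M c * f + g) = cinf_cst M c * D f + D g) /\
  (forall f g, D (f * g) = f * D g + g * D f).

(* [anchor X f] is rho(X)(f). *)
Record lie_algebroid (L : lmodType K) := LieAlgebroid {
  lbr : L -> L -> L;
  anchor : L -> K -> K;
  anchor_derivation : forall X, derivation (anchor X);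
  anchor_linear : forall f X Y g,
    anchor (f *: X + Y) g = f * anchor X g + anchor Y g;
  anchor_morphism : forall X Y f,
    anchor (lbr X Y) f = anchor X (anchor Y f) - anchor Y (anchor X f);
  lbr_linear : forall (c : R) X Y Z,
    lbr (cinf_cst M c *: X + Y) Z = cinf_cst M c *: lbr X Z + lbr Y Z;
  lbr_skew : forall X Y, lbr X Y = - lbr Y X;
  lbr_jacobi : forall X Y Z,
    lbr X (lbr Y Z) + lbr Y (lbr Z X) + lbr Z (lbr X Y) = 0;
  lbr_leibniz : forall X f Y, lbr X (f *: Y) = f *: lbr X Y + anchor X f *: Y
}.

End Derivations.

Section Forms.
Variables (R : realType) (n : nat) (M : manifold R n) (L : lmodType (Cinf M)).
Local Notation K := (Cinf M).

(* Sections of the k-th exterior power of A^* are the alternating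
   C^oo(M)-multilinear maps of k sections of A; sections of the k-th exterior
   power of A are then the case of L := dual_mod (Gamma A). Operations are defined
   on arbitrary maps of type [cochain k]. *)
Definition cochain (k : nat) := ('I_k -> L) -> K.

Definition subst_arg k (X : 'I_k -> L) (i : 'I_k) (Y : L) : 'I_k -> L :=
  fun j => if j == i then Y else X j.

Definition alternating_form k (w : cochain k) :=
  (forall X i (f : K) Y Z, w (subst_arg X i (f *: Y + Z)) =
      f * w (subst_arg X i Y) + w (subst_arg X i Z)) /\
  (forall X i j, i != j -> X i = X j -> w X = 0).

Definition cons_arg k (Y : L) (X : 'I_k -> L) : 'I_k.+1 -> L :=
  fun i => if unlift ord0 i is Some j then X j else Y.

Definition form0 (f : K) : cochain 0 := fun=> f.
Definition form1 (a : L -> K) : cochain 1 := fun X => a (X ord0).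

Definition interior_prod k (Y : L) (w : cochain k.+1) : cochain k :=
  fun X => w (cons_arg Y X).

Definition wedge1 (a : L -> K) k (w : cochain k) : cochain k.+1 := fun X =>
  \sum_(i < k.+1) (-1) ^+ i * (a (X i) * w (fun m => X (lift i m))).

Variable LA : lie_algebroid L.

(* For i < j, bump j (bump i m) is the m-th index distinct from i and j. *)
Definition ladiff k (w : cochain k) : cochain k.+1 := fun X =>
  \sum_(i < k.+1) (-1) ^+ i * anchor LA (X i) (w (fun m => X (lift i m))) +
  \sum_(i < k.+1) \sum_(j < k.+1 | (i < j)%N) (-1) ^+ (i + j) *
    w (fun m : 'I_k => if val m is m'.+1 then X (inord (bump j (bump i m')))
                       else lbr LA (X i) (X j)).

Definition cocycle1 (phi : dual_mod L) := forall X, ladiff (form1 phi) X = 0.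

(* d_phi w = d w + phi /\ w *)
Definition tdiff (phi : dual_mod L) k (w : cochain k) : cochain k.+1 := fun X =>
  ladiff w X + wedge1 phi w X.

(* The phi-Lie derivative d_phi i_Y + i_Y d_phi, with i_Y = 0 in degree 0. *)
Definition tlie (phi : dual_mod L) (Y : L) k : cochain k -> cochain k :=
  match k with
  | 0 => fun w => interior_prod Y (tdiff phi w)
  | k'.+1 => fun w X =>
      tdiff phi (interior_prod Y w) X + interior_prod Y (tdiff phi w) X
  end.

Lemma lie_dual_lin (X : L) (a : dual_mod L) :
  (fun Y => anchor LA X (a Y) - a (lbr LA X Y)) \in @lin_form R n M L.
Proof.
have [dadd dmul] := anchor_derivation LA X.
have addD f g : anchor LA X (f + g) = anchor LA X f + anchor LA X g.
  have c1 : cinf_cst M 1 = 1 by apply: val_inj.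
  by have := dadd 1 f g; rewrite c1 !mul1r.
have br_add Y Z : lbr LA X (Y + Z) = lbr LA X Y + lbr LA X Z.
  have c1 : cinf_cst M 1 = 1 by apply: val_inj.
  rewrite (lbr_skew LA) -[Y in LHS]scale1r -c1 lbr_linear c1 scale1r opprD.
  by rewrite -!(lbr_skew LA X).
apply/asboolP => f Y Z; rewrite dual_linear addD dmul br_add // lbr_leibniz.
rewrite !dualD !dualZ.
ring.
Qed.

Definition lie_dual (X : L) (a : dual_mod L) : dual_mod L := MkDual (lie_dual_lin X a).

(* The Schouten bracket [X, P] with X a section of A (degree 1): the derivation
   of the exterior algebra with [X, f] = rho(X)(f) extending [X, _], that is
   [X, P](a_1, .., a_k) = rho(X)(P(a_1, .., a_k)) - \sum_i P(.., L_X a_i, ..)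
   where (L_X a)(Y) = rho(X)(a Y) - a [X, Y]. *)
Definition schouten1 (X : L) k (P : ('I_k -> dual_mod L) -> K) :
    ('I_k -> dual_mod L) -> K := fun a =>
  anchor LA X (P a) -
  \sum_(i < k) P (fun j => if j == i then lie_dual X (a i) else a j).

(* The phi-Schouten bracket [X, P]_phi; in [P, P']_phi = [P, P'] + (-1)^(k+1) (k-1) P /\ i_phi P'
   - (k'-1) (i_phi P) /\ P' the middle term vanishes for k = 1. *)
Definition tschouten1 (phi : dual_mod L) (X : L) k (P : ('I_k -> dual_mod L) -> K) :
    ('I_k -> dual_mod L) -> K := fun a =>
  schouten1 X P a - (k%:R - 1) * (phi X * P a).

Lemma tdiff0E (phi : dual_mod L) (f : K) (X : 'I_1 -> L) :
  tdiff phi (form0 f) X = anchor LA (X ord0) f + phi (X ord0) * f.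
Proof.
rewrite /tdiff /ladiff /wedge1 !big_ord1 /form0 expr0 !mul1r.
by rewrite [X in _ + X + _]big_pred0 ?addr0 // => j; rewrite (ord1 j).
Qed.

Lemma tdiff0_lin (phi : dual_mod L) (f : K) :
  (fun X => tdiff phi (form0 f) (fun=> X)) \in @lin_form R n M L.
Proof.
by apply/asboolP => g X Y; rewrite !tdiff0E anchor_linear dual_linear; ring.
Qed.

(* d_phi f as a section of the dual bundle *)
Definition tdiff0 (phi : dual_mod L) (f : K) : dual_mod L := MkDual (tdiff0_lin phi f).

End Forms.

Section Bialgebroid.
Variables (R : realType) (n : nat) (M : manifold R n) (L : lmodType (Cinf M)).
Local Notation K := (Cinf M).

(* LA and LS are the Lie algebroid structures on A and on the dual of A.
   Pitfall: when A is a line bundle, glb_bracket is an equality of sections of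
   the null bundle of bivectors and holds trivially; it then does not force
   glb_fun_bracket to be skew-symmetric, as shown by A := TM for M the real
   line with its usual structure, A^* with rho_*(dx) := d/dx and
   [a dx, b dx]_* := (a b' - b a') dx, phi0 := 0 and X0 := 0, for which
   glb_fun_bracket f g = - f' g'. *)
Record generalized_lie_bialgebroid (LA : lie_algebroid L)
    (LS : lie_algebroid (dual_mod L)) (phi0 : dual_mod L) (X0 : L) : Prop := {
  glb_phi0 : cocycle1 LA phi0;
  glb_X0 : cocycle1 LS (eval_dual X0);
  glb_bracket : forall X Y (a : 'I_2 -> dual_mod L),
    let dS Z := tdiff LS (eval_dual X0) (form1 (eval_dual Z)) in
    dS (lbr LA X Y) a =
      tschouten1 LA phi0 X (dS Y) a - tschouten1 LA phi0 Y (dS X) a;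
  glb_lie : forall k (P : cochain (dual_mod L) k), alternating_form P ->
    forall a, tlie LS (eval_dual X0) phi0 P a + tschouten1 LA phi0 X0 P a = 0
}.

Definition glb_fun_bracket (LA : lie_algebroid L) (LS : lie_algebroid (dual_mod L))
    (phi0 : dual_mod L) (X0 : L) (f g : K) : K :=
  - tdiff0 LS (eval_dual X0) g (tdiff0 LA phi0 f).

End Bialgebroid.

Section Jacobi.
Variables (R : realType) (n : nat) (M : manifold R n).
Local Notation K := (Cinf M).

(* A k-vector field P on M is identified with the alternating k-derivation
   (f1, .., fk) |-> P(delta f1, .., delta fk) of C^oo(M). *)
Definition bivector (Lam : K -> K -> K) :=
  (forall f, derivation (Lam f)) /\ (forall f g, Lam f g = - Lam g f).

Definition wedge_vv (X Y : K -> K) f g : K := X f * Y g - X g * Y f.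

Definition wedge_vb (E : K -> K) (Lam : K -> K -> K) f g h : K :=
  E f * Lam g h - E g * Lam f h + E h * Lam f g.

Definition schouten_vb (E : K -> K) (Lam : K -> K -> K) f g : K :=
  E (Lam f g) - Lam (E f) g - Lam f (E g).

Definition schouten_bb (P Q : K -> K -> K) f g h : K :=
  (P (Q f g) h + P (Q g h) f + P (Q h f) g) +
  (Q (P f g) h + Q (P g h) f + Q (P h f) g).

Lemma derivationB D u v : derivation D -> D (u - v) = D u - D v :> K.
Proof.
have cN : cinf_cst M (-1) = -1 by apply: val_inj.
have -> : u - v = cinf_cst M (-1) * v + u by rewrite cN mulN1r addrC.
by case=> -> _; rewrite cN mulN1r addrC.
Qed.

(* With schouten_vb_wedge and symmetry, this graded Leibniz rule characterises
   the bracket of bivector fields, which are locally sums of products. *)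
Lemma schouten_bb_wedge P Z W f g h :
  bivector P -> derivation Z -> derivation W ->
  schouten_bb P (wedge_vv Z W) f g h =
    wedge_vb W (schouten_vb Z P) f g h - wedge_vb Z (schouten_vb W P) f g h.
Proof.
move=> [dP sP] dZ dW.
have PM u v w : P (u * v) w = u * P v w + v * P u w.
  by rewrite sP (dP w).2 (sP v w) (sP u w); ring.
have PB u v w : P (u - v) w = P u w - P v w.
  by rewrite sP (derivationB _ _ (dP w)) (sP u w) (sP v w); ring.
rewrite /schouten_bb /wedge_vv /wedge_vb /schouten_vb !PB !PM.
have DN (D : K -> K) (dD : derivation D) u : D (- u) = - D u.
  have d0 : D 0 = 0 by have := derivationB 0 0 dD; rewrite !subrr.
  by have := derivationB 0 u dD; rewrite d0 !sub0r.
rewrite (sP h f) (DN _ dZ) (DN _ dW).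
rewrite (sP f (Z h)) (sP f (W h)) (sP g (Z h)) (sP g (W h)).
rewrite (sP f (Z g)) (sP f (W g)).
ring.
Qed.

Lemma schouten_vb_wedge E Y Z f g :
  derivation E ->
  schouten_vb E (wedge_vv Y Z) f g =
    wedge_vv (fun u => E (Y u) - Y (E u)) Z f g +
    wedge_vv Y (fun u => E (Z u) - Z (E u)) f g.
Proof.
move=> dE.
by rewrite /schouten_vb /wedge_vv (derivationB _ _ dE) !(dE.2); ring.
Qed.

Definition jacobi_structure (Lam : K -> K -> K) (E : K -> K) :=
  [/\ bivector Lam, derivation E,
      forall f g h, schouten_bb Lam Lam f g h = wedge_vb E Lam f g h *+ 2 &
      forall f g, schouten_vb E Lam f g = 0].

Definition jacobi_bracket (Lam : K -> K -> K) (E : K -> K) f g : K :=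
  Lam f g + f * E g - g * E f.

Definition defines_jacobi_structure (br : K -> K -> K) :=
  exists Lam E, jacobi_structure Lam E /\
    forall f g, br f g = jacobi_bracket Lam E f g.

End Jacobi.

(* Main.v *)
Require Import Defs.
From mathcomp Require Import all_boot all_order all_algebra.
From mathcomp Require Import all_classical all_reals all_analysis.
From mathcomp Require Import ring.
Set Implicit Arguments.
Unset Strict Implicit.
Unset Printing Implicit Defensive.
Import Order.TTheory GRing.Theory Num.Theory.
Import numFieldNormedType.Exports.
Local Open Scope classical_set_scope.
Local Open Scope ring_scope.

(* The compatibility condition on functions gives <phi0, X0> = 0 and
   rho_* phi0 = - rho X0, so the bracket is the Jacobi bracket of
   Lam(f, g) = - rho_*(df) g and E = rho X0; on sections of A it gives
   [phi0, a]_* = - L_X0 a, whence [E, Lam] = 0.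
   Comparing the bracket condition at (X, f Y) and at (X, Y) shows that a
   section V(X, f) of A satisfies V(X, f) /\ Y = 0 for all Y. When the rank is
   at least 2, bump functions provide enough global sections to conclude
   V = 0; in rank 0, Lam = 0. Replacing X by g X in V(X, f) = 0 yields the
   skew-symmetry of Lam, and pairing V(X, f) with dg computes [df, dg]_*;
   applying rho_* to that formula gives [Lam, Lam] = 2 E /\ Lam. *)

(** * Flat functions on the real line *)

Section FlatFunction.
Variable R : realType.
Implicit Types (s : R) (m : nat).

(* The derivatives of exp(-1/s) are combinations of the s^-m exp(-1/s). *)
Definition flat m s : R := if 0 < s then s ^- m * expR (- s^-1) else 0.

Lemma flat_ge0 m s : 0 <= flat m s.
Proof.
rewrite /flat; case: ifP => // s0.
by rewrite mulr_ge0 ?expR_ge0// invr_ge0 exprn_ge0// ltW.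
Qed.

(** With t = 1/s the claim is t^m <= m! e^t, and t^m / m! is one term of the exponential series. *)
Lemma flat_le m s : flat m s <= m`!%:R.
Proof.
rewrite /flat; case: ifP => // s0.
have t0 : 0 <= s^-1 by rewrite invr_ge0 ltW.
rewrite -exprVn expRN ler_pdivrMr ?expR_gt0//.
case: m => [|m]; first by rewrite fact0 mul1r expr0 -expR0 ler_expR.
rewrite mulrC -ler_pdivrMr ?ltr0n ?fact_gt0//.
by apply: le_trans (expR_ge1Dxn m t0); rewrite lerDr ler01.
Qed.

(** Trading s^-m for s^-(m+2) s^2 gives the quadratic decay that makes the difference quotient at 0
    vanish. *)
Lemma flat_le_sqr m s : flat m s <= m.+2`!%:R * s ^+ 2.
Proof.
have [s0|s0] := ltP 0 s; last first.
  by rewrite /flat ltNge s0 /= mulr_ge0 ?sqr_ge0// ler0n.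
rewrite -ler_pdivrMr ?exprn_gt0//; apply: le_trans (flat_le m.+2 s).
rewrite /flat s0.
have -> : s ^- m.+2 = s ^- m / s ^+ 2 by rewrite -invfM -exprD addn2.
by rewrite mulrAC.
Qed.

(** The family is closed under differentiation up to linear combinations, so smoothness can be
    proved by induction on the order. *)
Lemma is_derive_flat m s :
  is_derive s 1 (flat m) (flat m.+2 s - m%:R * flat m.+1 s).
Proof.
have [s0|s0|<-] := ltgtP 0 s.
- pose V (y : R) := y^-1.
  refine (@near_eq_is_derive R R R (V ^+ m * (expR \o - V)) _ _ _ _ _ _).
    near=> y; rewrite /flat.
    have -> : 0 < y by near: y; exact: lt_nbhsr.
    by rewrite -exprVn mulrfctE /= exprfctE.
  have dV : is_derive s 1 V (- s ^- 2).
    apply: is_derive_eq (@is_deriveV _ id s 1 1 _ _) _; first by rewrite gt_eqF.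
    by rewrite /GRing.scale /= mulr1.
  have dX := is_deriveX m dV.
  have dE :=
    @is_derive1_comp R expR (- V) s _ _ (is_derive_expR _) (is_deriveN dV).
  apply: is_derive_eq (is_deriveM dX dE) _.
  rewrite /flat s0 /GRing.scale /= /V -!exprVn.
  rewrite exprfctE /=.
  case: m {dX} => [|m]; first by rewrite !expr0; ring.
  rewrite -pred_Sn !exprS; ring.
- refine (@near_eq_is_derive R R R (cst 0) _ _ _ _ _ _).
    near=> y; rewrite /flat ltNge.
    suff -> : y <= 0 by [].
    by apply: ltW; near: y; exact: lt_nbhsl.
  by rewrite /flat ltNge (ltW s0) /= mulr0 subr0; exact: is_derive_cst.
- have f0 k : flat k 0 = 0 by rewrite /flat ltxx.
  rewrite !f0 mulr0 subr0.
  suff fl : (fun h => h^-1 *: (flat m (h *: 1 + 0) - flat m 0)) @ (0 : R)^'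
      --> (0 : R).
    by apply: DeriveDef; [apply/cvg_ex; exists 0 | exact: cvg_lim].
  rewrite f0; apply/norm_cvg0P.
  (* At 0 the difference quotient is bounded by (m+2)! |h|. *)
  apply: (@squeeze_cvgr _ _ _ _ (cst 0) (fun h => m.+2`!%:R * `|h|)).
  + near=> h; rewrite normr_ge0 subr0 addr0 /GRing.scale /= mulr1 normrM normfV.
    have h0 : h != 0 by near: h; exact: nbhs_dnbhs_neq.
    rewrite [`|flat _ _|]ger0_norm ?flat_ge0// ler_pdivrMl ?normr_gt0//.
    apply: le_trans (flat_le_sqr m h) _.
    by rewrite [leRHS]mulrCA -expr2 real_normK ?num_real.
  + exact: cvg_cst.
  + suff : (fun h => m.+2`!%:R * `|h|) @ (0 : R)^' --> m.+2`!%:R * `|0 : R|.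
      by rewrite normr0 mulr0.
    apply: cvgM; first exact: cvg_cst.
    apply: cvg_norm; exact: nbhs_dnbhs.
Unshelve. all: by end_near. Qed.

End FlatFunction.

(** * Composition of flat functions with smooth functions *)

Section Composition.
Variables (R : realType) (n : nat).

(** Restricting to the line h v + x reduces directional derivatives to the one-variable chain
    rule. *)
Lemma is_derive1P (f : 'rV[R]_n -> R) (x v : 'rV[R]_n) df :
  is_derive x v f df <-> is_derive (0 : R) 1 (fun h : R => f (h *: v + x)) df.
Proof.
have e : 'D_1 (fun h : R => f (h *: v + x)) 0 = 'D_v f x.
  rewrite /derive.
  by under eq_fun do rewrite /= addr0 scale0r add0r [_%:A]mulr1.
split=> -[d1 d2].
  by apply: DeriveDef; [exact: (derivable1P f x v).1 | rewrite e].
by apply: DeriveDef; [exact: (derivable1P f x v).2 | rewrite -e].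
Qed.

Lemma is_derive_flat_comp m (u : 'rV[R]_n -> R) x v du :
  is_derive x v u du -> is_derive x v (flat m \o u)
    ((flat m.+2 (u x) - m%:R * flat m.+1 (u x)) * du).
Proof.
move=> /is_derive1P ud; apply/is_derive1P.
apply: is_derive1_comp ud.
by rewrite scale0r add0r; exact: is_derive_flat.
Qed.

Lemma continuous_flat m : continuous (@flat R m).
Proof.
move=> s; apply/differentiable_continuous/derivable1_diffP.
by have [] := is_derive_flat m s.
Qed.

(** Induction on k for all m at once, since the derivative involves the indices m+1 and m+2. *)
Lemma Ck_flat m k U (u : 'rV[R]_n -> R) : open U -> Ck k U u ->
  Ck k U (flat m \o u).
Proof.
move=> oU; elim: k m u => [|k IH] m u uk.
  split=> // x Ux; apply: continuous_comp; first exact: uk.1.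
  exact: continuous_flat.
have := uk => -[cu du]; split=> [x Ux|v].
  by apply: continuous_comp; [exact: cu|exact: continuous_flat].
have [du1 du2] := du v.
have dF x : U x -> is_derive x v (flat m \o u)
    ((flat m.+2 (u x) - m%:R * flat m.+1 (u x)) * 'D_v u x).
  by move=> Ux; apply: is_derive_flat_comp; apply: derivableP; exact: du1.
split=> [x /dF []//|].
apply: (@Ck_eq _ _ _ _
  ((flat m.+2 \o u + cst (- m%:R) * (flat m.+1 \o u)) * 'D_v u)) => //.
  move=> x /set_mem Ux; have [_ ->] := dF _ Ux.
  by rewrite !fctE /= mulNr.
have uk' := Ck_W uk.
apply: Ck_M => //; apply: Ck_D => //; first exact: IH.
by apply: Ck_M => //; [exact: Ck_cst | exact: IH].
Qed.

Lemma smooth_via_flat m (T : topologicalType) (phi : T -> 'rV[R]_n) x a :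
  smooth_via phi x a -> smooth_via phi x (flat m \o a).
Proof.
move=> [U [g [oU Ux sg ag]]]; exists U, (flat m \o g); split => //.
  by move=> k; exact: Ck_flat.
by near=> y; rewrite /= (near ag y).
Unshelve. all: by end_near. Qed.

End Composition.

(** * Bump functions on a manifold *)

Section BumpFunctions.
Variables (R : realType) (n : nat) (M : manifold R n).

Lemma smooth_via_sum (T : topologicalType) (phi : T -> 'rV[R]_n) x m
    (a : 'I_m -> T -> R) :
  (forall k, smooth_via phi x (a k)) -> smooth_via phi x (\sum_k a k).
Proof.
move=> sa; elim/big_ind: _ => //; first exact: smooth_via_cst.
by move=> f g; exact: smooth_via_D.
Qed.

Lemma smooth_at_chart i x k : cdom i x ->
  smooth_at (fun y : M => chart i y ord0 k) x.
Proof. by move=> ix j jx; exact: chart_smooth. Qed.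

(* Hausdorffness enters here: it makes the compact set closed in all of M. *)
Lemma closed_chart_preimage i (V : set M) (C : set 'rV[R]_n) :
  open V -> V `<=` cdom i -> compact C -> C `<=` chart i @` V ->
  closed (V `&` chart i @^-1` C).
Proof.
move=> oV Vi cC CV.
(* The inverse [psi] of the chart on V needs a point of V as default value. *)
have [[y0 Vy0]|noV] := pselect (exists y, V y); last first.
  have -> : V `&` chart i @^-1` C = set0.
    by apply/seteqP; split => // y [Vy _]; apply: noV; exists y.
  exact: closed0.
pose psi p := xget y0 (V `&` chart i @^-1` [set p]).
have psiP p : C p -> V (psi p) /\ chart i (psi p) = p.
  move=> /CV [y Vy yp]; rewrite /psi.
  by case: xgetP => [z -> [] //|/(_ y)[]].
have psiK y : V y -> psi (chart i y) = y.
  move=> Vy; rewrite /psi; case: xgetP => [z -> [Vz]|/(_ y)[]]//.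
  by apply: chart_inj; rewrite inE; exact: Vi.
(* The set is the image of a compact set under [psi], hence compact once [psi] is continuous on C;
   that continuity is the openness of the chart. *)
have -> : V `&` chart i @^-1` C = psi @` C.
  apply/seteqP; split => [y [Vy Cy]|_ [p Cp <-]].
    by exists (chart i y) => //; exact: psiK.
  by have [? e] := psiP _ Cp; split => //=; rewrite e.
apply: compact_closed; first exact: mhausdorff.
apply: continuous_compact => //.
apply: continuous_in_subspaceT => p /set_mem Cp N /= nN.
have [Vp pp] := psiP _ Cp.
have [B [oB Bp BN]] : exists B, [/\ open B, B (psi p) & B `<=` N `&` V].
  have : nbhs (psi p) (N `&` V) by apply: filterI => //; exact: open_nbhs_nbhs.
  by rewrite nbhsE => -[B [oB Bp] ?]; exists B.
have BV : B `<=` V by move=> y /BN[].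
have nB : nbhs p (chart i @` B).
  apply: open_nbhs_nbhs; split; last by exists (psi p).
  by apply: chart_open => //; exact: subset_trans BV Vi.
apply: filterS nB => _ [y By <-].
by rewrite /= psiK; [have [] := BN _ By | exact: BV].
Qed.

(** The function is exp(-1/u) for u = d^2 - |chart - p0|^2 where u > 0 inside V, and 0 elsewhere. It
    vanishes off a closed subset of W, hence near every point outside W. *)
Lemma bump_function (x : M) (W : set M) : open W -> W x ->
  exists2 b : Cinf M, b x != 0 &
    forall y, ~ W y -> \forall z \near y, b z = 0.
Proof.
move=> oW Wx; have [i ix] := cdom_cover x.
pose V := W `&` cdom i.
have oV : open V by apply: openI => //; exact: cdom_open.
have Vi : V `<=` cdom i by move=> y [].
have Vx : V x by [].
have nV : nbhs (chart i x) (chart i @` V).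
  by apply: open_nbhs_nbhs; split; [exact: chart_open | exists x].
have [e eV] := (nbhs_closedballP _ _).1 nV.
have d0 : 0 < e%:num by [].
pose d := e%:num; rewrite -/d in d0.
pose p0 := chart i x.
pose C := closed_ball p0 d.
have cC : compact C.
  apply: bounded_closed_compact; last exact: closed_ball_closed.
  rewrite /C closed_ballE//.
  exists (`|p0| + d); split; first exact: num_real.
  move=> r hr p /= pd; apply: le_trans (ltW hr).
  rewrite -[p](subrK p0) addrC; apply: le_trans (ler_normD _ _) _.
  by rewrite lerD2l distrC.
(* The squared Euclidean distance is smooth in the chart; the balls themselves are taken in the sup
   norm. *)
pose q y : R := \sum_k (chart i y ord0 k - p0 ord0 k) ^+ 2.
pose u y : R := d ^+ 2 - q y.
pose b y : R := if `[< V y >] then flat 0 (u y) else 0.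
(* Each squared coordinate is at most the sum q, so the Euclidean ball lies in the sup-norm ball. *)
have Cu y : 0 < u y -> C (chart i y).
  rewrite /u subr_gt0 => qd; rewrite /C closed_ballE// /closed_ball_ /=.
  rewrite {1}/Num.Def.normr /= mx_normrE.
  apply/bigmax_leP; split=> [|[k l] _]; first exact: ltW.
  rewrite !mxE ord1 /= distrC -ler_sqr ?nnegrE ?normr_ge0 ?(ltW d0)//.
  rewrite real_normK ?num_real//; apply: le_trans (ltW qd).
  by rewrite /q (bigD1 l)//= lerDl sumr_ge0// => ? _; exact: sqr_ge0.
have b0 y : ~ (V `&` chart i @^-1` C) y -> b y = 0.
  rewrite /b; case: asboolP => // Vy nCy.
  by rewrite /flat; case: ifP => // /Cu Cy; case: nCy.
have bnear y : ~ V y -> \forall z \near y, b z = 0.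
  move=> Vy.
  have cK := closed_chart_preimage oV Vi cC eV.
  have yK : (~` (V `&` chart i @^-1` C)) y by case.
  have oK : open (~` (V `&` chart i @^-1` C)) by rewrite openC.
  have := open_nbhs_nbhs (conj oK yK); apply: filterS => z; exact: b0.
have sb : b \in @smooth_fun R n M.
  apply/asboolP => y; have [Vy|/bnear by0] := pselect (V y); last first.
    apply: (@smooth_at_eq _ _ _ (cst 0)); last exact: smooth_at_cst.
    by apply: filterS by0.
  apply: (@smooth_at_eq _ _ _ (flat 0 \o u)).
    have := open_nbhs_nbhs (conj oV Vy); apply: filterS => z Vz.
    by rewrite /b asboolT.
  move=> j jy; apply: smooth_via_flat.
  have -> : u = cst (d ^+ 2) + cst (-1) * \sum_k
     (((fun y => chart i y ord0 k) + cst (- p0 ord0 k)) *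
      ((fun y => chart i y ord0 k) + cst (- p0 ord0 k))).
    apply/funext => z; rewrite !fctE /u /q /= mulN1r; congr (_ - _).
    by rewrite fct_sumE; apply: eq_bigr => k _; rewrite !fctE expr2.
  apply: smooth_via_D; first exact: smooth_via_cst.
  apply: smooth_via_M; first exact: smooth_via_cst.
  apply: smooth_via_sum => k.
  by apply: smooth_via_M; (apply: smooth_via_D;
    [apply: smooth_at_chart => //; exact: Vi|exact: smooth_via_cst]).
exists (MkCinf sb) => /=.
  rewrite /b asboolT// /flat.
  have -> : u x = d ^+ 2.
    by rewrite /u /q big1 ?subr0// => k _; rewrite subrr expr0n.
  by rewrite exprn_gt0// expr0 invr1 mul1r gt_eqF ?expR_gt0.
by move=> y Wy; apply: bnear => -[].
Qed.

End BumpFunctions.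

Local Notation coord := Defs.coord.

(** * Global sections and dual sections cut off from a local frame *)

Section LocalFrames.
Variables (R : realType) (n r : nat) (M : manifold R n) (A : vbundle M r).

Lemma coord0 t x i : tdom t x -> coord t i (0 : fib A x) = 0.
Proof.
move=> tx; have -> : (0 : fib A x) = -1 *: 0 + 0 by rewrite scaler0 addr0.
by rewrite coordZD// mulN1r addNr.
Qed.

Lemma coordZ t x (c : R) (u : fib A x) i : tdom t x ->
  coord t i (c *: u) = c * coord t i u.
Proof. by move=> tx; rewrite -[c *: u]addr0 coordZD// coord0// addr0. Qed.

Lemma coord_frame t x i j : tdom t x ->
  coord t i (frame t j x : fib A x) = (i == j)%:R.
Proof.
move=> tx; rewrite -[RHS](frame_free tx (fun k => (k == j)%:R) i).
congr coord; rewrite (bigD1 j)//= eqxx scale1r big1 ?addr0// => k /negbTE ->.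
by rewrite scale0r.
Qed.

Variables (t : triv A) (b : Cinf M).
Hypothesis b0 : forall y, ~ tdom t y -> \forall z \near y, b z = 0.

Lemma tdom_near s y : tdom s y -> \forall z \near y, tdom (v0 := A) s z.
Proof. by move=> sy; apply: open_nbhs_nbhs; split => //; exact: tdom_open. Qed.

Lemma cinf_smooth (f : Cinf M) y : smooth_at f y.
Proof. by case: f => f /= /asboolP. Qed.

(** Off [tdom t] the frame has arbitrary values, which the factor [b] replaces by zero. *)
Definition bump_frame_rough i : rough_section A := fun y => b y *: frame t i y.

Lemma bump_frame_smooth i : bump_frame_rough i \in smooth_section (A := A).
Proof.
apply/asboolP => s y sy j; have [ty|/b0 by0] := pselect (tdom t y).
  apply: (@smooth_at_eq _ _ _
      (cinf_val b * (fun z => coord s j (frame t i z)))).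
    near=> z; rewrite mulrfctE /bump_frame_rough coordZ//.
    by near: z; exact: tdom_near.
  by apply: smooth_atM; [exact: cinf_smooth | exact: transition_smooth].
apply: (@smooth_at_eq _ _ _ (cst 0)); last exact: smooth_at_cst.
near=> z; rewrite /bump_frame_rough (near by0 z)// scale0r coord0//.
by near: z; exact: tdom_near.
Unshelve. all: by end_near. Qed.

Definition bump_frame i : Gamma A := MkGamma (bump_frame_smooth i).

Lemma bump_coord_smooth i (Z : Gamma A) :
  (fun y => b y * coord t i (gamma_val Z y)) \in @smooth_fun R n M.
Proof.
apply/asboolP => y; have [ty|/b0 by0] := pselect (tdom t y).
  apply: smooth_atM; first exact: cinf_smooth.
  by case: Z => Z /= /asboolP; apply.
apply: (@smooth_at_eq _ _ _ (cst 0)); last exact: smooth_at_cst.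
by near=> z; rewrite (near by0 z)// mul0r.
Unshelve. all: by end_near. Qed.

Lemma bump_coord_lin i :
  (fun Z => MkCinf (bump_coord_smooth i Z)) \in @lin_form R n M (Gamma A).
Proof.
apply/asboolP => f X Y; apply: val_inj; apply/funext => y.
change (b y * coord t i (f y *: gamma_val X y + gamma_val Y y) =
  f y * (b y * coord t i (gamma_val X y)) + b y * coord t i (gamma_val Y y)).
(* Coordinates are linear only over [tdom t]; elsewhere [b] is zero and both sides vanish. *)
have [ty|/b0/nbhs_singleton ->] := pselect (tdom t y).
  by rewrite coordZD//; ring.
by rewrite !mul0r mulr0 addr0.
Qed.

Definition bump_coord i : dual_mod (Gamma A) := MkDual (bump_coord_lin i).

Lemma bump_coord_frame i j y : tdom t y ->
  (bump_coord i (bump_frame j) : Cinf M) y = b y ^+ 2 * (i == j)%:R.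
Proof.
move=> ty.
change (b y * coord t i (b y *: frame t j y) = b y ^+ 2 * (i == j)%:R).
by rewrite coordZ// coord_frame// mulrA.
Qed.

End LocalFrames.

(** * Pointwise dual bases and cancellation of minors *)

Section LocalCoframe.
Variables (R : realType) (n r : nat) (M : manifold R n) (A : vbundle M r).

(** The cut-off frame and coframe are dual at x up to the factor b(x)^2, one [b] coming from
    each. *)
Lemma local_coframe (x : M) :
  exists c (X : 'I_r -> Gamma A) (a : 'I_r -> dual_mod (Gamma A)),
    c != 0 /\ forall i j, (a i (X j) : Cinf M) x = c * (i == j)%:R.
Proof.
have [t tx] := tdom_cover A x.
have [b bx b0] := bump_function (tdom_open t) tx.
exists (b x ^+ 2), (bump_frame b0), (bump_coord b0); split.
  by rewrite expf_neq0.
by move=> i j; exact: bump_coord_frame.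
Qed.

(** At each point x, two of the cut-off sections and their dual sections have minor c^2, which is
    not 0. *)
Lemma rank_ge2_minor_cancel (u : Cinf M) : (1 < r)%N ->
  (forall (a1 a2 : dual_mod (Gamma A)) X Y,
     u * (a1 X * a2 Y - a2 X * a1 Y : Cinf M) = 0) -> u = 0.
Proof.
move=> r2 u0; apply: val_inj; apply/funext => x.
have [c [X [a [c0 aX]]]] := local_coframe x.
pose i0 : 'I_r := Ordinal (ltnW r2); pose i1 : 'I_r := Ordinal r2.
have := congr1 (fun f : Cinf M => f x) (u0 (a i0) (a i1) (X i0) (X i1)).
change (u x * ((a i0 (X i0) : Cinf M) x * (a i1 (X i1) : Cinf M) x -
  (a i1 (X i0) : Cinf M) x * (a i0 (X i1) : Cinf M) x) = 0 -> u x = 0).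
rewrite !aX !eqxx /= !(mulr1, mulr0) subr0 => /eqP.
by rewrite !mulf_eq0 (negbTE c0) !orbF => /eqP.
Qed.

End LocalCoframe.

(** * Calculus on a Lie algebroid *)

Section AlgebroidTheory.
Variables (R : realType) (n : nat) (M : manifold R n) (L : lmodType (Cinf M)).
Local Notation K := (Cinf M).
Variable LA : lie_algebroid L.

Lemma anchorD X Y g : anchor LA (X + Y) g = anchor LA X g + anchor LA Y g.
Proof. by rewrite -[X]scale1r anchor_linear mul1r scale1r. Qed.

Lemma anchor0 g : anchor LA 0 g = 0.
Proof. by apply: (addIr (anchor LA 0 g)); rewrite -anchorD !add0r. Qed.

Lemma anchorZ f X g : anchor LA (f *: X) g = f * anchor LA X g.
Proof. by rewrite -[f *: X]addr0 anchor_linear anchor0 addr0. Qed.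

Lemma anchorN X g : anchor LA (- X) g = - anchor LA X g.
Proof. by rewrite -scaleN1r anchorZ mulN1r. Qed.

Lemma cinf_cst1 : cinf_cst M 1 = 1. Proof. exact: val_inj. Qed.

Lemma anchorDr X f g : anchor LA X (f + g) = anchor LA X f + anchor LA X g.
Proof.
by have := (anchor_derivation LA X).1 1 f g; rewrite cinf_cst1 !mul1r.
Qed.

Lemma anchor0r X : anchor LA X 0 = 0.
Proof. by apply: (addIr (anchor LA X 0)); rewrite -anchorDr !add0r. Qed.

Lemma anchorNr X f : anchor LA X (- f) = - anchor LA X f.
Proof.
by apply: (addIr (anchor LA X f)); rewrite -anchorDr !addNr anchor0r.
Qed.

Lemma anchorMr X f g :
  anchor LA X (f * g) = f * anchor LA X g + g * anchor LA X f.
Proof. exact: (anchor_derivation LA X).2. Qed.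

Lemma anchor1r X : anchor LA X 1 = 0.
Proof.
have := anchorMr X 1 1; rewrite !mul1r => e.
by apply: (addIr (anchor LA X 1)); rewrite add0r -e.
Qed.

Lemma lbrDl X Y Z : lbr LA (X + Y) Z = lbr LA X Z + lbr LA Y Z.
Proof.
by rewrite -[X in LHS]scale1r -cinf_cst1 lbr_linear cinf_cst1 scale1r.
Qed.

Lemma lbrZl f X Y :
  lbr LA (f *: X) Y = f *: lbr LA X Y - anchor LA Y f *: X.
Proof. by rewrite lbr_skew lbr_leibniz opprD -scalerN -lbr_skew. Qed.

(* Fixes the codomain as K: the coercion of dual_mod lands in K^o. *)
Definition ev (a : dual_mod L) (X : L) : K := a X.

Lemma evDr a X Y : ev a (X + Y) = ev a X + ev a Y. Proof. exact: dualD. Qed.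
Lemma evZr a f X : ev a (f *: X) = f * ev a X. Proof. exact: dualZ. Qed.
Lemma evNr a X : ev a (- X) = - ev a X.
Proof. by rewrite -scaleN1r evZr mulN1r. Qed.
Lemma evDl a b X : ev (a + b) X = ev a X + ev b X. Proof. by []. Qed.
Lemma evZl f a X : ev (f *: a) X = f * ev a X. Proof. by []. Qed.
Lemma evNl a X : ev (- a) X = - ev a X. Proof. by []. Qed.

Lemma dual_ext (a b : dual_mod L) : (forall X, ev a X = ev b X) -> a = b.
Proof. by move=> ab; apply: val_inj; apply/funext. Qed.

Lemma differential_lin (f : K) : (fun X => anchor LA X f) \in @lin_form R n M L.
Proof. by apply/asboolP => g X Y; exact: anchor_linear. Qed.

(** This is the transpose of the anchor applied to the de Rham differential of f. *)
Definition differential (f : K) : dual_mod L := MkDual (differential_lin f).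

Lemma ev_differential f X : ev (differential f) X = anchor LA X f.
Proof. by []. Qed.

Lemma ev_lie_dual X a Y :
  ev (lie_dual LA X a) Y = anchor LA X (ev a Y) - ev a (lbr LA X Y).
Proof. by []. Qed.

Lemma lie_dualZl f X a :
  lie_dual LA (f *: X) a = f *: lie_dual LA X a + ev a X *: differential f.
Proof.
apply: dual_ext => Y.
rewrite evDl !evZl !ev_lie_dual ev_differential anchorZ lbrZl evDr evNr !evZr.
ring.
Qed.

(** The Lie derivative commutes with the differential on functions because the anchor preserves
    brackets. *)
Lemma lie_dual_differential X f :
  lie_dual LA X (differential f) = differential (anchor LA X f).
Proof.
apply: dual_ext => Y.
by rewrite ev_lie_dual !ev_differential anchor_morphism; ring.
Qed.

Lemma tdiff0_differential phi f :
  tdiff0 LA phi f = differential f + f *: phi.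
Proof.
apply: dual_ext => Y; rewrite evDl evZl ev_differential.
by rewrite /ev /= tdiff0E mulrC.
Qed.

Lemma tdiff1E (phi : dual_mod L) (p : L -> K) (X : 'I_2 -> L) :
  tdiff LA phi (form1 p) X =
  anchor LA (X ord0) (p (X ord_max)) - anchor LA (X ord_max) (p (X ord0))
  - p (lbr LA (X ord0) (X ord_max))
  + ev phi (X ord0) * p (X ord_max) - ev phi (X ord_max) * p (X ord0).
Proof.
have l0 : lift ord0 ord0 = ord_max :> 'I_2 by apply: val_inj.
have l1 : lift ord_max ord0 = ord0 :> 'I_2 by apply: val_inj.
rewrite /tdiff /ladiff /wedge1 /form1.
rewrite !big_mkcond !big_ord_recl !big_ord0 /= !l0 !l1.
do 2 rewrite [\sum_(j < 2 | _) _]big_mkcond !big_ord_recl !big_ord0 /= ?l0.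
rewrite /ev /bump /=; ring.
Qed.

End AlgebroidTheory.

(** * The compatibility conditions in low degree *)

Section BialgebroidTheory.
Variables (R : realType) (n : nat) (M : manifold R n) (L : lmodType (Cinf M)).
Local Notation K := (Cinf M).
Variables (LA : lie_algebroid L) (LS : lie_algebroid (dual_mod L)).
Variables (phi0 : dual_mod L) (X0 : L).
Hypothesis HG : generalized_lie_bialgebroid LA LS phi0 X0.
Local Notation rho := (anchor LA).
Local Notation rhos := (anchor LS).
Local Notation d := (differential LA).

(** The Lie derivative condition in degree 0. One copy of <phi0, X0> f comes from the
    X0-differential, the other from the coefficient k - 1 = -1 in the twisted Schouten bracket. *)
Lemma glb_lie0 f : rhos phi0 f + rho X0 f + ev phi0 X0 * f *+ 2 = 0.
Proof.
have alt0 : alternating_form (form0 f : cochain (dual_mod L) 0).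
  by split=> [? []|? []].
rewrite -[RHS](glb_lie HG alt0 (fun=> 0)).
rewrite /tlie /interior_prod tdiff0E /tschouten1 /schouten1 big_ord0 /form0 /=.
by rewrite /cons_arg unlift_none /ev /=; ring.
Qed.

(** At f = 1 both anchor terms vanish, and 2 is invertible among the functions. *)
Lemma phi0_X0 : ev phi0 X0 = 0.
Proof.
have := glb_lie0 1; rewrite !anchor1r !add0r mulr1 => e.
have c2 : cinf_cst M 2^-1 * 2%:R = 1.
  apply: val_inj; apply/funext => x.
  change (2^-1 * 2 = 1 :> R); by rewrite mulVf ?pnatr_eq0.
rewrite -[LHS]mul1r -c2 -mulrA [2%:R * _]mulr_natl -mulr_natl.
by rewrite mulr_natl e mulr0.
Qed.

Lemma rhos_phi0 f : rhos phi0 f = - rho X0 f.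
Proof.
have := glb_lie0 f; rewrite phi0_X0 mul0r mul0rn addr0 => /eqP.
by rewrite addr_eq0 => /eqP.
Qed.

(** The Lie derivative condition in degree 1. A section of A enters as a linear functional p on dual
    sections, so p may be taken to be b |-> rho_*(b) f. *)
Lemma glb_lie1 (p : dual_mod L -> K) a :
  (forall f b c, p (f *: b + c) = f * p b + p c) ->
  p (lbr LS phi0 a + lie_dual LA X0 a) = 0.
Proof.
move=> plin.
have pD b c : p (b + c) = p b + p c by rewrite -[b]scale1r plin mul1r scale1r.
have alt1 : alternating_form (form1 p).
  split=> [X i f Y Z|X i j]; last by rewrite (ord1 i) (ord1 j).
  by rewrite /form1 /subst_arg (ord1 i) eqxx plin.
have := glb_lie HG alt1 (fun=> a).
rewrite /tlie /interior_prod tdiff1E /tschouten1 /schouten1 big_ord1 /form1 /=.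
have -> : (fun X : 'I_0 -> dual_mod L => p (cons_arg phi0 X ord0))
   = form0 (p phi0) by apply/funext => X; rewrite /cons_arg unlift_none.
rewrite tdiff0E.
rewrite /cons_arg unlift_none /=.
have -> : unlift ord0 (ord_max : 'I_2) = Some ord0.
  by rewrite (_ : ord_max = lift ord0 ord0) ?liftK//; exact: val_inj.
rewrite /= rhos_phi0 /=.
have -> : (phi0 X0 : K) = 0 by exact: phi0_X0.
move=> e; rewrite pD; apply/eqP; rewrite -oppr_eq0 -[X in _ == X]e; apply/eqP.
ring.
Qed.

Lemma anchor_lbr_phi0 a f :
  rhos (lbr LS phi0 a) f = - rhos (lie_dual LA X0 a) f.
Proof.
have := @glb_lie1 (fun a => rhos a f) a.
rewrite anchorD => e; apply/eqP; rewrite -addr_eq0 e// => g b c.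
exact: anchor_linear.
Qed.

(** This is [E, Lam] = 0: the anchor of [phi0, df]_* is expanded as a commutator, with rho_* phi0 =
    - rho X0. *)
Lemma rho_X0_pairing f g :
  rho X0 (rhos (d f) g) = rhos (d (rho X0 f)) g + rhos (d f) (rho X0 g).
Proof.
have := anchor_lbr_phi0 (d f) g.
rewrite anchor_morphism !rhos_phi0 lie_dual_differential anchorNr => e.
apply/eqP; rewrite -subr_eq0 -oppr_eq0; apply/eqP.
have -> : rhos (d (rho X0 f)) g = - (- rhos (d (rho X0 f)) g) by rewrite opprK.
rewrite -e; ring.
Qed.

(* d_{*X0} Z evaluated on (a1, a2) *)
Definition bidiff Z a1 a2 : K :=
  rhos a1 (ev a2 Z) - rhos a2 (ev a1 Z) - ev (lbr LS a1 a2) Z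
  + ev a1 X0 * ev a2 Z - ev a2 X0 * ev a1 Z.

Lemma glb_bracketE X Y a1 a2 :
  bidiff (lbr LA X Y) a1 a2 =
  (rho X (bidiff Y a1 a2)
   - (bidiff Y (lie_dual LA X a1) a2 + bidiff Y a1 (lie_dual LA X a2))
   - ev phi0 X * bidiff Y a1 a2)
  - (rho Y (bidiff X a1 a2)
   - (bidiff X (lie_dual LA Y a1) a2 + bidiff X a1 (lie_dual LA Y a2))
   - ev phi0 Y * bidiff X a1 a2).
Proof.
have := glb_bracket HG X Y (fun i : 'I_2 => if i == ord0 then a1 else a2).
rewrite /= /tschouten1 /schouten1 !big_ord_recl !big_ord0 !tdiff1E /=.
(* The coefficient k - 1 of the twisted Schouten bracket, for bivectors. *)
have -> : 2%:R - 1 = 1 :> K by ring.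
by rewrite !addr0 !mul1r => e; exact: e.
Qed.

Lemma bidiffZ f Z a1 a2 :
  bidiff (f *: Z) a1 a2 =
  f * bidiff Z a1 a2 + rhos a1 f * ev a2 Z - rhos a2 f * ev a1 Z.
Proof. by rewrite /bidiff !evZr !anchorMr; ring. Qed.

Lemma bidiffD Z Z' a1 a2 :
  bidiff (Z + Z') a1 a2 = bidiff Z a1 a2 + bidiff Z' a1 a2.
Proof. by rewrite /bidiff !evDr !anchorDr; ring. Qed.

Lemma bidiffDl Z a1 b1 a2 :
  bidiff Z (a1 + b1) a2 = bidiff Z a1 a2 + bidiff Z b1 a2.
Proof. by rewrite /bidiff !evDl lbrDl !evDl anchorD anchorDr; ring. Qed.

(** The derivative of f produced by the anchor cancels the one produced by the bracket. *)
Lemma bidiffZl f Z a1 a2 : bidiff Z (f *: a1) a2 = f * bidiff Z a1 a2.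
Proof.
by rewrite /bidiff !evZl lbrZl !evDl evNl !evZl anchorZ anchorMr; ring.
Qed.

Lemma bidiff_skew Z a1 a2 : bidiff Z a1 a2 = - bidiff Z a2 a1.
Proof. by rewrite /bidiff (lbr_skew LS a1) evNl; ring. Qed.

Lemma bidiffDr Z a1 a2 b2 :
  bidiff Z a1 (a2 + b2) = bidiff Z a1 a2 + bidiff Z a1 b2.
Proof. by rewrite bidiff_skew bidiffDl 2!(bidiff_skew _ a1); ring. Qed.

Lemma bidiffZr f Z a1 a2 : bidiff Z a1 (f *: a2) = f * bidiff Z a1 a2.
Proof. by rewrite bidiff_skew bidiffZl (bidiff_skew _ a1); ring. Qed.

(* The section V(X, f) = d_*(rho(X) f) - [X, d_* f] + <phi0, X> d_* f
   + i_df (d_{*X0} X) of A, paired with a. *)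
Definition leibniz_defect X f a : K :=
  rhos a (rho X f) - rho X (rhos a f) + rhos (lie_dual LA X a) f
  + ev phi0 X * rhos a f + bidiff X (d f) a.

Lemma leibniz_defect_wedge X f Y a1 a2 :
  leibniz_defect X f a1 * ev a2 Y = leibniz_defect X f a2 * ev a1 Y.
Proof.
have := glb_bracketE X (f *: Y) a1 a2; have := glb_bracketE X Y a1 a2.
move=> /eqP; rewrite -subr_eq0; set u2 := (X in X == 0) => /eqP u20.
move=> /eqP; rewrite -subr_eq0; set u1 := (X in X == 0) => /eqP u10.
apply/eqP; rewrite -subr_eq0; apply/eqP.
(* Here [u1] and [u2] are the two sides' differences at (X, f Y) and (X, Y); subtracting f [u2]
   leaves only the terms that differentiate f. *)
suff -> : leibniz_defect X f a1 * ev a2 Y - leibniz_defect X f a2 * ev a1 Y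
    = u1 - f * u2 by rewrite u10 u20 mulr0 subr0.
rewrite /u1 /u2 lbr_leibniz bidiffD !bidiffZ evZr !lie_dualZl.
rewrite !bidiffDl !bidiffDr !bidiffZl !bidiffZr.
move: (bidiff Y a1 a2) (bidiff X a1 a2) => bY bX.
rewrite !anchorDr !anchorNr !anchorMr !anchorZ !ev_lie_dual.
rewrite (bidiff_skew X a1 (d f)) /leibniz_defect.
ring.
Qed.

(** The failure of V to be linear in X is exactly the symmetric part of the pairing of df and dg. *)
Lemma leibniz_defectZ g X f a :
  leibniz_defect (g *: X) f a =
  g * leibniz_defect X f a + ev a X * (rhos (d f) g + rhos (d g) f).
Proof.
rewrite /leibniz_defect !anchorZ !anchorMr lie_dualZl anchorD !anchorZ evZr.
by rewrite bidiffZ ev_differential; ring.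
Qed.

(** * Skew-symmetry and the bracket of differentials, when no nonzero function annihilates all 2x2
    minors *)

Section Nondegenerate.

Hypothesis minor_cancel : forall u : K,
  (forall (a1 a2 : dual_mod L) X Y,
     u * (ev a1 X * ev a2 Y - ev a2 X * ev a1 Y) = 0) -> u = 0.

(** With s the symmetric part, V(g X, f) /\ Y = 0 and g V(X, f) /\ Y = 0 leave s X /\ Y = 0, so s
    annihilates every minor. *)
Lemma pairing_skew f g : rhos (d f) g = - rhos (d g) f.
Proof.
apply/eqP; rewrite -addr_eq0; apply/eqP; apply: minor_cancel => a1 a2 X Y.
have := leibniz_defect_wedge (g *: X) f Y a1 a2.
have := leibniz_defect_wedge X f Y a1 a2.
rewrite !leibniz_defectZ => e1 e2.
have e3 : ev a1 X * (rhos (d f) g + rhos (d g) f) * ev a2 Y =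
          ev a2 X * (rhos (d f) g + rhos (d g) f) * ev a1 Y.
  by move: e2; rewrite !mulrDl -!mulrA e1 => /addrI.
transitivity (ev a1 X * (rhos (d f) g + rhos (d g) f) * ev a2 Y -
  ev a2 X * (rhos (d f) g + rhos (d g) f) * ev a1 Y); first by ring.
by rewrite e3 subrr.
Qed.

(** Moving V from a to a1 to a2 by V /\ X' = 0 and V /\ Y' = 0 makes the two products in V(a) times
    the minor equal. *)
Lemma leibniz_defect0 X f a : leibniz_defect X f a = 0.
Proof.
apply: minor_cancel => a1 a2 X' Y'.
have w Y b c := leibniz_defect_wedge X f Y b c.
transitivity (leibniz_defect X f a * ev a1 X' * ev a2 Y' -
  leibniz_defect X f a * ev a2 X' * ev a1 Y'); first by ring.
by rewrite (w X' a a1) (w X' a a2) mulrAC (w Y' a1 a2) mulrAC subrr.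
Qed.

Lemma lbr_differential f g :
  lbr LS (d f) (d g) =
  rho X0 f *: d g - rho X0 g *: d f + rhos (d g) f *: phi0 - d (rhos (d g) f).
Proof.
apply: dual_ext => X; rewrite !(evDl, evNl, evZl) !ev_differential.
have := leibniz_defect0 X f (d g).
rewrite /leibniz_defect /bidiff lie_dual_differential !ev_differential.
(* Skew-symmetry cancels rho_*(d(rho X g)) f against rho_*(df)(rho X g), leaving [df, dg]_* paired
   with X to be solved for. *)
rewrite (pairing_skew (rho X g)) => e.
apply/eqP; rewrite -subr_eq0 -oppr_eq0 -[X in _ == X]e; apply/eqP; ring.
Qed.

End Nondegenerate.

(** * The Jacobi structure and its bracket *)

Lemma glb_jacobi_structure :
  (forall f g, rhos (d f) g = - rhos (d g) f) ->
  (forall f g, lbr LS (d f) (d g) = rho X0 f *: d g - rho X0 g *: d f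
     + rhos (d g) f *: phi0 - d (rhos (d g) f)) ->
  jacobi_structure (fun f g => - rhos (d f) g) (rho X0).
Proof.
move=> skew brE; split.
- split=> [f|f g]; last by rewrite [in LHS]skew.
  have [D1 D2] := anchor_derivation LS (d f).
  by split=> [c g h|g h]; [rewrite D1; ring | rewrite D2; ring].
- exact: anchor_derivation.
- move=> f g h; rewrite /schouten_bb /wedge_vb.
  (* The anchor turns the bracket of differentials into a commutator of derivations, here applied to
     h. *)
  have := congr1 (fun a => rhos a h) (brE f g).
  rewrite anchor_morphism !(anchorD, anchorN, anchorZ) rhos_phi0.
  rewrite ![rhos (d (- _)) _]skew ![rhos (d (rhos _ _)) _]skew !anchorNr !opprK.
  rewrite (skew g f) (skew h f) !anchorNr => /eqP.
  rewrite -subr_eq0; set u := (X in X == 0) => /eqP u0.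
  apply/eqP; rewrite -subr_eq0; apply/eqP.
  (* The second-order part of [u] is minus the cyclic sum, which [Lam, Lam] contains twice. *)
  by transitivity (- 2 * u); [rewrite /u; ring | rewrite u0 mulr0].
- by move=> f g; rewrite /schouten_vb anchorNr rho_X0_pairing; ring.
Qed.

(** Expanding -<df + f phi0, d_* g + g X0>, the cross terms are <phi0, d_* g> = - E(g) and <df, X0>
    = E(f), while <phi0, X0> = 0. *)
Lemma glb_fun_bracketE f g :
  glb_fun_bracket LA LS phi0 X0 f g =
  jacobi_bracket (fun f g => - rhos (d f) g) (rho X0) f g.
Proof.
rewrite /glb_fun_bracket /jacobi_bracket /= tdiff0_differential tdiff0E.
rewrite !(anchorD, anchorZ) rhos_phi0.
have -> : (eval_dual X0 (d f + f *: phi0) : K) =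
  rho X0 f + f * ev phi0 X0 by [].
by rewrite phi0_X0; ring.
Qed.

End BialgebroidTheory.

Theorem theorem4p6 (R : realType) (n : nat) (M : manifold R n)
    (r : nat) (A : vbundle M r) (rank_neq1 : r != 1%N)
    (LA : lie_algebroid (Gamma A)) (LS : lie_algebroid (dual_mod (Gamma A)))
    (phi0 : dual_mod (Gamma A)) (X0 : Gamma A)
    (HG : generalized_lie_bialgebroid LA LS phi0 X0) :
  defines_jacobi_structure (glb_fun_bracket LA LS phi0 X0).
Proof.
exists (fun f g => - anchor LS (differential LA f) g), (anchor LA X0).
split; last by move=> f g; exact: (glb_fun_bracketE HG).
(* Rank at least 2 supplies nonzero minors; in rank 1 all minors vanish. *)
have [r1|r1] := ltnP 1 r.
  have cancel := @rank_ge2_minor_cancel _ _ _ _ A ^~ r1.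
  apply: (glb_jacobi_structure HG).
    exact: (pairing_skew HG cancel).
  exact: (lbr_differential HG cancel).
(* In rank 0 all sections and dual sections are zero, so both required identities are trivial. *)
have r0 : r = 0%N
  by move: r1; rewrite leq_eqVlt (negbTE rank_neq1) ltnS leqn0 => /eqP.
have fib0 x (v : fib A x) : v = 0.
  have [t tx] := tdom_cover A x.
  by rewrite -(frame_span tx v) big1// => i; have := ltn_ord i; rewrite {2}r0.
have sec0 (X : Gamma A) : X = 0.
  apply: val_inj; apply: functional_extensionality_dep => x.
  by rewrite [LHS]fib0 [RHS]fib0.
have dual0 (a b : dual_mod (Gamma A)) : a = b.
  by apply: dual_ext => X; rewrite (sec0 X) -(scale0r 0) !evZr !mul0r.
apply: (glb_jacobi_structure HG) => [f g|f g]; last exact: dual0.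
rewrite (dual0 (differential _ f) 0) (dual0 (differential _ g) 0).
by rewrite !anchor0 oppr0.
Qed.
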